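(* Let $\mathcal F$ be a set of $2$-edge-coloured graphs on three vertices. In any of the following cases, the $\mathcal F$-free colouring problem reduces (in polynomial time) to $2$-SAT: (a) $\mathcal F$ contains no triangle; (b) $\mathcal F$ contains all triangles, i.e. $\{{}^rK_3,{}^bK_3,{}^{rrb}K_3,{}^{rbb}K_3\}\subseteq\mathcal F$; (c) the subset of triangles of $\mathcal F$ is $\{{}^rK_3,{}^{rrb}K_3\}$; (d) the subset of triangles of $\mathcal F$ is $\{{}^bK_3,{}^{rbb}K_3\}$.
   Context: Graphs are finite and simple. A $2$-edge-colouring of $G$ assigns to every edge the colour red or blue (not necessarily properly). For a set $\mathcal F$ of $2$-edge-coloured graphs, a $2$-edge-colouring of $G$ is $\mathcal F$-free if no induced $2$-edge-coloured subgraph is isomorphic (preserving colours) to a member of $\mathcal F$. The $\mathcal F$-free colouring problem is to decide whether an input graph $G$ admits an $\mathcal F$-free $2$-edge-colouring. The $2$-edge-coloured triangles are: ${}^rK_3$ (resp. ${}^bK_3$), with all edges red (resp. blue); ${}^{rrb}K_3$, with two red and one blue edge; ${}^{rbb}K_3$, with one red and two blue edges. The remaining $2$-edge-coloured graphs on three vertices, which may also belong to $\mathcal F$, are the edgeless graph, the two colourings of the one-edge graph, and the three colourings of the path $P_3$. *)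

(* Defs.v *)
From mathcomp Require Import all_boot.
Set Implicit Arguments.
Unset Strict Implicit.
Unset Printing Implicit Defensive.

Record sgraph := SGraph {
  gvert : finType;
  gedge : rel gvert;
  gedge_sym : symmetric gedge;
  gedge_irr : irreflexive gedge }.

Definition colour := bool.
Definition red : colour := true.
Definition blue : colour := false.

(* A 2-edge-coloured graph: [ccol u v] is [None] when u and v are not adjacent,
   and [Some c] when uv is an edge of colour c. *)
Record cgraph := CGraph {
  cvert : finType;
  ccol : cvert -> cvert -> option colour;
  ccol_sym : forall u v, ccol u v = ccol v u;
  ccol_irr : forall u, ccol u u = None }.

Definition isomorphic (H K : cgraph) : Prop :=
  exists f : cvert H -> cvert K,
    bijective f /\ forall u v, ccol (f u) (f v) = ccol u v.

Section Induced.
Variables (H : cgraph) (S : {set cvert H}).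
Let T : finType := {x : cvert H | x \in S}.
Let col (u v : T) : option colour := ccol (val u) (val v).

Lemma induced_sym (u v : T) : col u v = col v u.
Proof. exact: ccol_sym. Qed.

Lemma induced_irr (u : T) : col u u = None.
Proof. exact: ccol_irr. Qed.

Definition induced : cgraph := CGraph induced_sym induced_irr.
End Induced.

(* The values of a 2-edge-colouring on non-edges are irrelevant: they are
   discarded by [coloured]. *)
Record colouring (G : sgraph) := Colouring {
  colour_of : gvert G -> gvert G -> colour;
  colour_of_sym : forall u v, colour_of u v = colour_of v u }.

Section Coloured.
Variables (G : sgraph) (c : colouring G).
Let col (u v : gvert G) : option colour :=
  if gedge u v then Some (colour_of c u v) else None.

Lemma coloured_sym (u v : gvert G) : col u v = col v u.
Proof. by rewrite /col gedge_sym colour_of_sym. Qed.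

Lemma coloured_irr (u : gvert G) : col u u = None.
Proof. by rewrite /col gedge_irr. Qed.

Definition coloured : cgraph := CGraph coloured_sym coloured_irr.
End Coloured.

(* Membership in a set of 2-edge-coloured graphs, which are taken up to
   isomorphism. *)
Definition contains (F : cgraph -> Prop) (H : cgraph) : Prop :=
  exists K, F K /\ isomorphic K H.

Definition is_free (F : cgraph -> Prop) (H : cgraph) : Prop :=
  forall S : {set cvert H}, ~ contains F (induced S).

Definition triangle (H : cgraph) : Prop :=
  #|cvert H| = 3 /\ forall u v : cvert H, u != v -> ccol u v <> None.

(* [K3 x y]: the edge {0,1} has colour x, the two edges at vertex 2 have
   colour y. *)
Section K3.
Variables x y : colour.
Let col (u v : 'I_3) : option colour :=
  if u == v then None
  else if (u == ord_max) || (v == ord_max) then Some y else Some x.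

Lemma K3_sym (u v : 'I_3) : col u v = col v u.
Proof. by rewrite /col eq_sym orbC. Qed.

Lemma K3_irr (u : 'I_3) : col u u = None.
Proof. by rewrite /col eqxx. Qed.

Definition K3 : cgraph := CGraph K3_sym K3_irr.
End K3.

Definition rK3 : cgraph := K3 red red.
Definition bK3 : cgraph := K3 blue blue.
Definition rrbK3 : cgraph := K3 blue red.
Definition rbbK3 : cgraph := K3 red blue.

(* A random access machine with a read-only input array, an append-only output
   tape, registers indexed by nat and holding natural numbers, indirect
   addressing, addition and truncated subtraction.  Each instruction costs one
   unit of time.  There is no multiplication, so values gain at most one bit per
   step, and polynomial time in the bit length of the input is the same as for
   Turing machines (Cook and Reckhow 1973; Papadimitriou, Computational
   Complexity, Section 2.6). *)
Inductive instr :=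
  | ConstReg of nat & nat           (* R[r] <- k *)
  | AddReg of nat & nat & nat       (* R[r] <- R[s] + R[t] *)
  | SubReg of nat & nat & nat       (* R[r] <- R[s] - R[t] *)
  | LoadReg of nat & nat            (* R[r] <- R[R[s]] *)
  | StoreReg of nat & nat           (* R[R[r]] <- R[s] *)
  | ReadIn of nat & nat             (* R[r] <- input[R[s]], or 0 out of range *)
  | PrintOut of nat                 (* append R[r] to the output *)
  | JumpPos of nat & nat.           (* goto j if R[r] > 0 *)

Definition program := seq instr.

Record config := Config {
  pc : nat;
  reg : nat -> nat;
  out : seq nat }.

Definition init : config := Config 0 (fun=> 0) [::].

Definition upd (m : nat -> nat) (r v : nat) : nat -> nat :=
  fun s => if s == r then v else m s.

Definition exec (x : seq nat) (i : instr) (c : config) : config :=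
  let: Config l m o := c in
  match i with
  | ConstReg r k => Config l.+1 (upd m r k) o
  | AddReg r s t => Config l.+1 (upd m r (m s + m t)) o
  | SubReg r s t => Config l.+1 (upd m r (m s - m t)) o
  | LoadReg r s => Config l.+1 (upd m r (m (m s))) o
  | StoreReg r s => Config l.+1 (upd m (m r) (m s)) o
  | ReadIn r s => Config l.+1 (upd m r (nth 0 x (m s))) o
  | PrintOut r => Config l.+1 m (rcons o (m r))
  | JumpPos r j => Config (if 0 < m r then j else l.+1) m o
  end.

(* The machine halts when the program counter leaves the program. *)
Definition halted (p : program) (c : config) : bool := size p <= pc c.

Definition step (p : program) (x : seq nat) (c : config) : config :=
  if halted p c then c else exec x (nth (ConstReg 0 0) p (pc c)) c.

Definition outputs_within (p : program) (x y : seq nat) (t : nat) : Prop :=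
  let c := iter t (step p x) init in halted p c /\ out c = y.

Definition bitlen (n : nat) : nat := (trunc_log 2 n).+1.
Definition wsize (x : seq nat) : nat := \sum_(n <- x) bitlen n.

Record problem := Problem {
  instance : Type;
  encode : instance -> seq nat;
  yes : instance -> Prop }.

Definition polytime (A B : problem) (f : instance A -> instance B) : Prop :=
  exists (p : program) (a k : nat), forall i : instance A,
    outputs_within p (encode i) (encode (f i)) (a * wsize (encode i) ^ k + a).

Definition poly_reduces (A B : problem) : Prop :=
  exists f : instance A -> instance B,
    polytime f /\ forall i, yes i <-> yes (f i).

(* The number of vertices followed by the adjacency matrix, row by row. *)
Definition encode_graph (G : sgraph) : seq nat :=
  #|gvert G| ::
    [seq nat_of_bool (gedge u v) | u <- enum (gvert G), v <- enum (gvert G)].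

Definition free_colouring (F : cgraph -> Prop) : problem :=
  Problem encode_graph
    (fun G => exists c : colouring G, is_free F (coloured c)).

(* A literal (v, b) is the variable number v if b, and its negation otherwise.
   Every clause has two literals, which may be equal. *)
Definition literal := (nat * bool)%type.
Definition clause := (literal * literal)%type.
Definition cnf2 := seq clause.

Definition sat_lit (s : nat -> bool) (l : literal) : bool := s l.1 == l.2.
Definition sat_clause (s : nat -> bool) (C : clause) : bool :=
  sat_lit s C.1 || sat_lit s C.2.

Definition encode_cnf2 (phi : cnf2) : seq nat :=
  flatten [seq [:: C.1.1; nat_of_bool C.1.2; C.2.1; nat_of_bool C.2.2]
          | C <- phi].

Definition two_sat : problem :=
  Problem encode_cnf2 (fun phi => exists s, all (sat_clause s) phi).

(* Main.v *)
Require Import Defs.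
From mathcomp Require Import all_boot perm.
From mathcomp Require Import boolp zify.

(* A colouring is F-free iff, for all vertices i < j < k, the coloured graph
   induced on them is not in F.  With one Boolean variable per edge, this is,
   for each triple and its adjacency pattern, a constraint on at most three
   variables; in each of the four cases the set of allowed values is closed
   under coordinatewise majority, hence is defined by the 2-clauses that it
   implies.  These 2-clauses depend only on the adjacency pattern, so a machine
   with three nested loops over the vertices can print them from a finite
   table.  The variable of the edge ij is the address of the entry ij of the
   adjacency matrix in the input. *)

Set Implicit Arguments.
Unset Strict Implicit.
Unset Printing Implicit Defensive.

(** * Hoare triples for structured machine code *)

(* Jump targets are absolute, so code depends on its start address. *)
Definition code := nat -> program.

Definition block (s : program) : code := fun=> s.
Definition seqc (C D : code) : code := fun l => C l ++ D (l + size (C l)).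
Definition unless (r : nat) (C : code) : code :=
  fun l => JumpPos r (l.+1 + size (C l.+1)) :: C l.+1.
Definition dowhile (C : code) (r : nat) : code :=
  fun l => rcons (C l) (JumpPos r l).

Definition assertion := (nat -> nat) -> seq nat -> Prop.

(** The surrounding program is arbitrary, so that triples compose; the final registers and output
    are chosen before it and hence do not depend on it. Termination within [T] steps is part of the
    claim. *)
Definition hoare (x : seq nat) (C : code) (P Q : assertion) (T : nat) : Prop :=
  forall m o, P m o -> exists m' o', Q m' o' /\
    forall p1 p2, exists2 t, t <= T &
      iter t (step (p1 ++ C (size p1) ++ p2) x) (Config (size p1) m o) =
      Config (size p1 + size (C (size p1))) m' o'.

Lemma hoare_seq x C D P Q R T U :
  hoare x C P Q T -> hoare x D Q R U -> hoare x (seqc C D) P R (T + U).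
Proof.
move=> hC hD m o /hC[m1 [o1 [/hD[m2 [o2 [hR runD]]] runC]]].
exists m2, o2; split=> // p1 p2.
have [t tT eC] := runC p1 (D (size p1 + size (C (size p1))) ++ p2).
have [u uU eD] := runD (p1 ++ C (size p1)) p2.
exists (u + t); first by rewrite addnC leq_add.
rewrite iterD /seqc -catA eC; move: eD.
by rewrite size_cat -catA size_cat addnA.
Qed.

Lemma hoare_imp x C (P P' Q Q' : assertion) T T' :
  (forall m o, P' m o -> P m o) -> (forall m o, Q m o -> Q' m o) -> T <= T' ->
  hoare x C P Q T -> hoare x C P' Q' T'.
Proof.
move=> hP hQ leT h m o /hP/h[m' [o' [/hQ q run]]].
exists m', o'; split=> // p1 p2; have [t tT e] := run p1 p2.
by exists t => //; apply: leq_trans leT.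
Qed.

Lemma step_cat p1 i s x m o :
  step (p1 ++ i :: s) x (Config (size p1) m o) = exec x i (Config (size p1) m o).
Proof.
by rewrite /step /halted /= size_cat /= leqNgt -addSnnS leq_addr nth_cat ltnn subnn.
Qed.

Definition straight (i : instr) : bool :=
  if i is JumpPos _ _ then false else true.

Definition effect x (s : program) m o : config :=
  foldl (fun c i => exec x i c) (Config 0 m o) s.

Lemma hoare_block x s P Q :
  all straight s ->
  (forall m o, P m o -> let c := effect x s m o in Q (reg c) (out c)) ->
  hoare x (block s) P Q (size s).
Proof.
move=> str hPQ m o /hPQ /= hQ; exists (reg (effect x s m o)), (out (effect x s m o)).
split=> // p1 p2; exists (size s) => //; rewrite /block /effect.
(* The counter in [effect] is generalised to [l]: straight-line instructions only increment it, so
   registers and output do not depend on it. *)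
move: str; clear; move: 0 => l; elim: s l m o p1 => [|i s IH] l m o p1 /=.
  by rewrite addn0.
case/andP=> si str; rewrite -iterS iterSr step_cat.
rewrite -cat_rcons addnS -addSn.
have {}IH m' o' := IH l.+1 m' o' (rcons p1 i) str.
by case: i si (size_rcons p1 i) IH => //= [r k|r u t|r u t|r u|r u|r u|r] _ <- IH;
  rewrite IH.
Qed.

Lemma hoare_unless x r C P Q T :
  (forall m o, P m o -> 0 < m r -> Q m o) ->
  hoare x C (fun m o => P m o /\ m r = 0) Q T ->
  hoare x (unless r C) P Q T.+1.
Proof.
move=> hskip hC m o hP; have [r0|r_gt0] := posnP (m r).
  have [m' [o' [hQ run]]] := hC _ _ (conj hP r0).
  exists m', o'; split=> // p1 p2; rewrite /unless.
  set j := JumpPos _ _; have [t tT e] := run (rcons p1 j) p2.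
  exists t.+1 => //; rewrite iterSr /= step_cat /= r0 /=.
  by move: e; rewrite size_rcons cat_rcons addSnnS.
exists m, o; split; first exact: hskip.
by move=> p1 p2; exists 1 => //=; rewrite step_cat /= r_gt0 addSnnS.
Qed.

(** The body runs before the test, hence [0 < n]. The register [r] counts the rounds still to come,
    so the jump back is taken in every round but the last. *)
Lemma hoare_dowhile x C r n T (Inv : nat -> assertion) :
  0 < n ->
  (forall i, i < n ->
    hoare x C (Inv i) (fun m o => Inv i.+1 m o /\ m r = n - i.+1) T) ->
  hoare x (dowhile C r) (Inv 0) (Inv n) (n * T.+1).
Proof.
move=> n_gt0 body.
suff loop d i : i + d.+1 = n -> hoare x (dowhile C r) (Inv i) (Inv n) (d.+1 * T.+1).
  by case: n n_gt0 body loop => // n _ _; apply.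
elim: d i => [|d IH] i def_n m o.
  have lt_in : i < n by rewrite -def_n addn1.
  case/(body i lt_in)=> m' [o' [[hI r0] run]].
  exists m', o'; split=> [|p1 p2]; first by rewrite -def_n addn1.
  have [t tT e] := run p1 (JumpPos r (size p1) :: p2).
  exists t.+1; first by rewrite mul1n.
  rewrite /dowhile cat_rcons iterS e catA -size_cat step_cat /= r0 -def_n addn1 subnn.
  by rewrite size_cat size_rcons addnS.
have lt_in : i < n by rewrite -def_n addnS ltnS leq_addr.
case/(body i lt_in)=> m1 [o1 [[hI r1] run1]].
have [|m2 [o2 [hI2 run2]]] := IH i.+1 _ m1 o1 hI; first by rewrite addSnnS.
exists m2, o2; split=> // p1 p2.
have [t tT e] := run1 p1 (JumpPos r (size p1) :: p2).
have [u uU e2] := run2 p1 p2.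
exists (u + t.+1); first by rewrite addnC mulSn leq_add.
rewrite iterD iterS -{}e2 /dowhile cat_rcons e catA -size_cat step_cat /= r1.
by rewrite -def_n -addSnnS addKn.
Qed.

(** Without surroundings the run ends just past the program, where the machine has halted; [step]
    fixes halted configurations, so waiting until [T'] changes nothing. *)
Lemma outputs_of_hoare C x y T T' :
  hoare x C (fun m o => m = reg init /\ o = [::]) (fun _ o => o = y) T ->
  T <= T' -> outputs_within (C 0) x y T'.
Proof.
case/(_ _ _ (conj erefl erefl))=> m [o [def_o run]] leT.
have [t tT e] := run [::] [::]; rewrite /= cats0 add0n in e.
have := leq_trans tT leT => /subnK <-; rewrite /outputs_within iterD e.
elim: (T' - t) => [|d [hd od]]; first by rewrite /halted /=.
by rewrite iterS /step hd.
Qed.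

(** * The program that prints the clauses of all vertex triples *)

Definition cell (n u v : nat) : nat := 1 + u * n + v.

Section TriangleLoop.
(** The finite table: to an adjacency pattern of ij, ik, jk it assigns clauses whose variables 0, 1,
    2 stand for these edges in this order. *)
Variable tpl : bool * bool * bool -> cnf2.
Hypothesis tpl_vars : forall a, all (fun C => (C.1.1 < 3) && (C.2.1 < 3)) (tpl a).
Variable x : seq nat.
Let n := nth 0 x 0.

Definition adjacent (u v : nat) : bool := 0 < nth 0 x (cell n u v).

Definition edge_var (i j k e : nat) : nat :=
  nth 0 [:: cell n i j; cell n i k; cell n j k] e.

Definition rename (f : nat -> nat) (C : clause) : clause :=
  ((f C.1.1, C.1.2), (f C.2.1, C.2.2)).

Definition pattern_cnf (i j k : nat) (a : bool * bool * bool) : cnf2 :=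
  if [&& i < j, j < k & (adjacent i j, adjacent i k, adjacent j k) == a]
  then map (rename (edge_var i j k)) (tpl a) else [::].

Definition triple_cnf (i j k : nat) : cnf2 :=
  flatten (map (pattern_cnf i j k) (enum {: bool * bool * bool})).
Definition pair_cnf (i j k : nat) : cnf2 := flatten (mkseq (triple_cnf i j) k).
Definition row_cnf (i j : nat) : cnf2 := flatten (mkseq (pair_cnf i ^~ n) j).
Definition graph_cnf (i : nat) : cnf2 := flatten (mkseq (row_cnf ^~ n) i).

(* Registers: 0 and 1 hold the constants 0 and 1, 2 holds n, 3 and 4 hold i and
   1 + i * n, 5 and 6 hold j and 1 + j * n, 7 holds k; 8-10 are the variables of
   the edges ij, ik, jk, 11-13 their adjacency bits and 14-16 the complements of
   these bits; 17 is 0 iff i < j < k, 18 is 0 iff moreover the current adjacency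
   pattern matches, and 19 controls the loops. *)
Definition print_clause (C : clause) : program :=
  [:: PrintOut (8 + C.1.1); PrintOut C.1.2; PrintOut (8 + C.2.1); PrintOut C.2.2].

(** A conjunction is tested as a vanishing sum: an adjacency bit is added where the pattern has a
    non-edge, its complement where it has an edge. *)
Definition pattern_code (a : bool * bool * bool) : code :=
  seqc (block [:: AddReg 18 (if a.1.1 then 14 else 11) (if a.1.2 then 15 else 12);
                  AddReg 18 18 (if a.2 then 16 else 13);
                  AddReg 18 18 17])
       (unless 18 (block (flatten (map print_clause (tpl a))))).

Definition patterns_code (s : seq (bool * bool * bool)) : code :=
  foldr (fun a => seqc (pattern_code a)) (block [::]) s.

(** By truncated subtraction, [(i + 1 - j) + (j + 1 - k)] is 0 iff [i < j < k]; register 18 is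
    scratch space here. *)
Definition setup_code : code :=
  seqc (block [:: AddReg 8 4 5; AddReg 9 4 7; AddReg 10 6 7])
    (seqc (block [:: ReadIn 11 8; ReadIn 12 9; ReadIn 13 10])
      (seqc (block [:: SubReg 14 1 11; SubReg 15 1 12; SubReg 16 1 13])
         (block [:: AddReg 17 3 1; SubReg 17 17 5; AddReg 18 5 1; SubReg 18 18 7;
                    AddReg 17 17 18]))).

Definition k_code : code :=
  seqc setup_code
    (seqc (patterns_code (enum {: bool * bool * bool}))
          (block [:: AddReg 7 7 1; SubReg 19 2 7])).
Definition j_code : code :=
  seqc (block [:: ConstReg 7 0])
    (seqc (dowhile k_code 19) (block [:: AddReg 5 5 1; AddReg 6 6 2; SubReg 19 2 5])).
Definition i_code : code :=
  seqc (block [:: ConstReg 5 0; ConstReg 6 1])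
    (seqc (dowhile j_code 19) (block [:: AddReg 3 3 1; AddReg 4 4 2; SubReg 19 2 3])).
(** Since loops run at least once, the empty graph is skipped: register 19 receives [1 - n], which
    is positive only for [n = 0]. *)
Definition main_code : code :=
  seqc (block [:: ConstReg 1 1; ReadIn 2 0; ConstReg 4 1; ConstReg 6 1; SubReg 19 1 2])
    (unless 19 (dowhile i_code 19)).

Definition regs (i j k : nat) (m : nat -> nat) : Prop :=
  [/\ m 0 = 0, m 1 = 1, m 2 = n &
    [/\ m 3 = i, m 4 = 1 + i * n, m 5 = j, m 6 = 1 + j * n & m 7 = k]].

Definition edge_regs (i j k : nat) (m : nat -> nat) : Prop :=
  [/\ m 8 = cell n i j, m 9 = cell n i k & m 10 = cell n j k].

Definition bit_regs (i j k : nat) (m : nat -> nat) : Prop :=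
  [/\ m 11 = nth 0 x (cell n i j), m 12 = nth 0 x (cell n i k)
    & m 13 = nth 0 x (cell n j k)].

Definition cobit_regs (m : nat -> nat) : Prop :=
  [/\ m 14 = 1 - m 11, m 15 = 1 - m 12 & m 16 = 1 - m 13].

Definition ready (i j k : nat) (m : nat -> nat) : Prop :=
  [/\ regs i j k m, edge_regs i j k m, bit_regs i j k m, cobit_regs m
    & m 17 = (i + 1 - j) + (j + 1 - k)].

Lemma encode_cnf2_cat (p q : cnf2) :
  encode_cnf2 (p ++ q) = encode_cnf2 p ++ encode_cnf2 q.
Proof. by rewrite /encode_cnf2 map_cat flatten_cat. Qed.

Lemma hoare_print i j k (s : cnf2) o0 :
  all (fun C => (C.1.1 < 3) && (C.2.1 < 3)) s ->
  hoare x (block (flatten (map print_clause s)))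
    (fun m o => ready i j k m /\ o = o0)
    (fun m o => ready i j k m /\
       o = o0 ++ encode_cnf2 (map (rename (edge_var i j k)) s))
    (size (flatten (map print_clause s))).
Proof.
move=> vs; apply: hoare_block; first by elim: s {vs}.
move=> m o [hm ->]; rewrite /effect; move: 0 => l.
elim: s vs l o0 => [_ l o0|[[v b] [w d]] s IH] /=; first by rewrite cats0.
case/andP=> /andP[v3 w3] /IH{}IH l o0.
pose o1 := rcons (rcons (rcons (rcons o0 (m (8 + v))) (m b)) (m (8 + w))) (m d).
have [hI hO] := IH l.+4 o1.
split=> //; rewrite hO /o1 -!cats1 -!catA; congr (_ ++ _) => /=.
case: hm => [[m0 m1 _ _] [m8 m9 m10] _ _ _].
(* Registers 8 to 10 hold the edge variables. Registers 0 and 1 hold their own index, so a sign is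
   printed by using it as a register number. *)
have varE e : e < 3 -> m (8 + e) = edge_var i j k e by case: e => [|[|[|]]].
have boolE (c : bool) : m c = c by case: c.
by rewrite !varE // !boolE.
Qed.

Lemma hoare_pattern i j k a o0 :
  hoare x (pattern_code a)
    (fun m o => ready i j k m /\ o = o0)
    (fun m o => ready i j k m /\ o = o0 ++ encode_cnf2 (pattern_cnf i j k a))
    (3 + (size (flatten (map print_clause (tpl a)))).+1).
Proof.
pose cond := [&& i < j, j < k & (adjacent i j, adjacent i k, adjacent j k) == a].
apply: (hoare_seq (Q := fun m o =>
  [/\ ready i j k m, o = o0 & (m 18 == 0) = cond])).
  apply: hoare_block => // m o [[hr h8 h11 h14 h17] ->].
  case: a @cond => [[a b] c] cond; split=> //.
  rewrite /= /upd /=.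
  have -> : m (if a then 14 else 11) = if a then 1 - m 11 else m 11.
    by case: a {cond}; case: h14.
  have -> : m (if b then 15 else 12) = if b then 1 - m 12 else m 12.
    by case: b {cond}; case: h14.
  have e16 : m 16 = 1 - m 13 by case: h14.
  case: h11 => e11 e12 e13.
  rewrite /cond /adjacent -e11 -e12 -e13 h17 !xpair_eqE.
  by case: a {cond}; case: b; case: c => //=; rewrite ?e16; lia.
apply: hoare_unless => [m o [hr -> c0] m18|].
  by split=> //; rewrite /pattern_cnf -/cond -c0 eqn0Ngt m18 cats0.
rewrite /pattern_cnf -/cond; case: cond; last by move=> m o [[_ _ /eqP]].
by apply: hoare_imp (@hoare_print i j k _ o0 (tpl_vars a)) => // m o [[]].
Qed.

Definition patterns_time (s : seq (bool * bool * bool)) : nat :=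
  sumn [seq 3 + (size (flatten (map print_clause (tpl a)))).+1 | a <- s].

Lemma hoare_patterns i j k s o0 :
  hoare x (patterns_code s)
    (fun m o => ready i j k m /\ o = o0)
    (fun m o => ready i j k m /\
       o = o0 ++ encode_cnf2 (flatten (map (pattern_cnf i j k) s)))
    (patterns_time s).
Proof.
elim: s o0 => [|a s IH] o0.
  by apply: hoare_block => // m o [hr ->]; rewrite cats0.
apply: hoare_seq (@hoare_pattern i j k a o0) _.
by rewrite /= encode_cnf2_cat catA; apply: IH.
Qed.

Definition k_time := 14 + (patterns_time (enum {: bool * bool * bool}) + 2).
Definition j_time := 1 + (n * k_time.+1 + 3).
Definition i_time := 2 + (n * j_time.+1 + 3).
Definition main_time := 5 + (n * i_time.+1).+1.

Lemma hoare_setup i j k o0 :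
  hoare x setup_code (fun m o => regs i j k m /\ o = o0)
    (fun m o => ready i j k m /\ o = o0) 14.
Proof.
apply: (hoare_seq (T := 3) (U := 11) (Q := fun m o =>
  [/\ regs i j k m, edge_regs i j k m & o = o0])).
  apply: hoare_block => // m o [[m0 m1 m2 [m3 m4 m5 m6 m7]] ->].
  by rewrite /regs /edge_regs /= /upd /= m0 m1 m2 m3 m4 m5 m6 m7.
apply: (hoare_seq (T := 3) (U := 8) (Q := fun m o =>
  [/\ regs i j k m, edge_regs i j k m, bit_regs i j k m & o = o0])).
  apply: hoare_block => // m o [hr [m8 m9 m10] ->].
  by rewrite /edge_regs /bit_regs /= /upd /= m8 m9 m10.
apply: (hoare_seq (T := 3) (U := 5) (Q := fun m o =>
  [/\ regs i j k m, edge_regs i j k m, bit_regs i j k m, cobit_regs m & o = o0])).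
  apply: hoare_block => // m o [[m0 m1 m2 hr] he hb ->].
  by rewrite /regs /cobit_regs /= /upd /= m0 m1 m2.
apply: hoare_block => // m o [[m0 m1 m2 [m3 m4 m5 m6 m7]] he hb hc ->].
by rewrite /ready /regs /= /upd /= m0 m1 m2 m3 m4 m5 m6 m7.
Qed.

Lemma hoare_k i j k o0 :
  hoare x k_code (fun m o => regs i j k m /\ o = o0)
    (fun m o => (regs i j k.+1 m /\ o = o0 ++ encode_cnf2 (triple_cnf i j k))
       /\ m 19 = n - k.+1) k_time.
Proof.
apply: hoare_seq (@hoare_setup i j k o0) (hoare_seq (@hoare_patterns i j k _ o0) _).
apply: hoare_block => // m o [[[m0 m1 m2 [m3 m4 m5 m6 m7]] _ _ _ _] ->].
by rewrite /regs /= /upd /= m0 m1 m2 m3 m4 m5 m6 m7 addn1.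
Qed.

(** The precondition leaves the old innermost counter open, because the code resets it first. *)
Lemma hoare_j i j o0 : 0 < n ->
  hoare x j_code (fun m o => (exists k, regs i j k m) /\ o = o0)
    (fun m o => ((exists k, regs i j.+1 k m) /\ o = o0 ++ encode_cnf2 (pair_cnf i j n))
       /\ m 19 = n - j.+1) j_time.
Proof.
move=> n_gt0; pose Inv k (m : nat -> nat) (o : seq nat) :=
  regs i j k m /\ o = o0 ++ encode_cnf2 (pair_cnf i j k).
apply: hoare_seq (hoare_seq (hoare_dowhile (Inv := Inv) n_gt0 _) _).
- apply: hoare_block => // m o [[k [m0 m1 m2 [m3 m4 m5 m6 m7]]] ->].
  by rewrite /Inv /regs /= /upd /= cats0.
- move=> k _; pose o1 := o0 ++ encode_cnf2 (pair_cnf i j k).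
  apply: hoare_imp (@hoare_k i j k o1) => //.
  move=> m o [[hr ->] m19]; split=> //; split=> //.
  by rewrite -catA -encode_cnf2_cat -flatten_rcons -mkseqS.
apply: hoare_block => // m o [[m0 m1 m2 [m3 m4 m5 m6 m7]] ->].
rewrite /regs /= /upd /= m0 m1 m2 m3 m4 m5 m6 m7 addn1; split=> //; split=> //.
by exists n; rewrite mulSnr addnA.
Qed.

Lemma hoare_i i o0 : 0 < n ->
  hoare x i_code (fun m o => (exists j k, regs i j k m) /\ o = o0)
    (fun m o => ((exists j k, regs i.+1 j k m) /\ o = o0 ++ encode_cnf2 (row_cnf i n))
       /\ m 19 = n - i.+1) i_time.
Proof.
move=> n_gt0; pose Inv j (m : nat -> nat) (o : seq nat) :=
  (exists k, regs i j k m) /\ o = o0 ++ encode_cnf2 (row_cnf i j).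
apply: hoare_seq (hoare_seq (hoare_dowhile (Inv := Inv) n_gt0 _) _).
- apply: hoare_block => // m o [[j [k [m0 m1 m2 [m3 m4 m5 m6 m7]]]] ->].
  by rewrite /Inv /= /upd /= cats0; split=> //; exists k.
- move=> j _; pose o1 := o0 ++ encode_cnf2 (row_cnf i j).
  apply: hoare_imp (@hoare_j i j o1 n_gt0) => //.
  move=> m o [[hr ->] m19]; split=> //; split=> //.
  by rewrite -catA -encode_cnf2_cat -flatten_rcons -mkseqS.
apply: hoare_block => // m o [[k [m0 m1 m2 [m3 m4 m5 m6 m7]]] ->].
rewrite /regs /= /upd /= m0 m1 m2 m3 m4 m5 addn1; split=> //; split=> //.
by exists n, k; rewrite mulSnr addnA.
Qed.

Lemma hoare_main :
  hoare x main_code (fun m o => m = reg init /\ o = [::])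
    (fun _ o => o = encode_cnf2 (graph_cnf n)) main_time.
Proof.
pose start (m : nat -> nat) := regs 0 0 0 m /\ m 19 = 1 - n.
apply: (hoare_seq (Q := fun m o => start m /\ o = [::])).
  by apply: hoare_block => // m o [-> ->]; rewrite /start /regs /= /upd /=.
apply: hoare_unless => [m o [[_ ->] ->]|].
  by rewrite subn_gt0 ltnS leqn0 => /eqP n0; rewrite n0.
pose Inv i (m : nat -> nat) (o : seq nat) :=
  (exists j k, regs i j k m) /\ o = encode_cnf2 (graph_cnf i).
have [n0|n_gt0] := posnP n.
  by move=> m o [[[_ ->] _]]; rewrite n0.
apply: (@hoare_imp _ _ (Inv 0) _ (Inv n) _ (n * i_time.+1)) => //.
- by move=> m o [[[hr _] ->] _]; split=> //; exists 0, 0.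
- by move=> m o [].
apply: (hoare_dowhile n_gt0) => i _.
apply: hoare_imp (@hoare_i i (encode_cnf2 (graph_cnf i)) n_gt0) => //.
move=> m o [[hr ->] m19]; split=> //; split=> //.
by rewrite -encode_cnf2_cat -flatten_rcons -mkseqS.
Qed.

End TriangleLoop.

(** * Isomorphism and coloured graphs on three vertices *)

Lemma isomorphic_sym H K : isomorphic H K -> isomorphic K H.
Proof.
case=> f [[g fK gK] hf]; exists g; split; first by exists f.
by move=> u v; rewrite -hf !gK.
Qed.

Lemma isomorphic_trans H K L :
  isomorphic H K -> isomorphic K L -> isomorphic H L.
Proof.
case=> f [bf hf] [g [bg hg]]; exists (g \o f); split; first exact: bij_comp.
by move=> u v /=; rewrite hg hf.
Qed.

Lemma contains_iso F H K : isomorphic H K -> contains F H -> contains F K.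
Proof. by move=> HK [L [FL LH]]; exists L; split=> //; apply: isomorphic_trans HK. Qed.

Section Tri.
Variables o01 o02 o12 : option colour.
(** The sum of two distinct indices identifies the edge: 1 for 01, 2 for 02, 3 for 12. *)
Let col (u v : 'I_3) : option colour :=
  if u == v then None
  else if u + v == 1 then o01 else if u + v == 2 then o02 else o12.

Lemma tri_sym u v : col u v = col v u.
Proof. by rewrite /col eq_sym addnC. Qed.

Lemma tri_irr u : col u u = None.
Proof. by rewrite /col eqxx. Qed.

Definition tri : cgraph := CGraph tri_sym tri_irr.
End Tri.

Lemma ord3_ind (P : 'I_3 -> Prop) :
  P (inord 0) -> P (inord 1) -> P (inord 2) -> forall u, P u.
Proof.
move=> P0 P1 P2 u; rewrite -(inord_val u).
by case: u => [[|[|[|u]]] lt_u3].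
Qed.

Lemma tri_triangle x y z : triangle (tri (Some x) (Some y) (Some z)).
Proof.
split=> [|u v /negPf /= ->]; first by rewrite card_ord.
by case: ifP => // _; case: ifP.
Qed.

Lemma tri_K3P x y z p q :
  isomorphic (tri (Some x) (Some y) (Some z)) (K3 p q) <->
  (x, y, z) \in [:: (p, q, q); (q, p, q); (q, q, p)].
Proof.
rewrite !inE; split.
  case=> f [_ hf].
  have h01 := hf (inord 0) (inord 1); have h02 := hf (inord 0) (inord 2).
  have h12 := hf (inord 1) (inord 2); move: h01 h02 h12 => /=.
  move: (f (inord 0)) (f (inord 1)) (f (inord 2)).
  rewrite -!(inj_eq val_inj) /= !inordK //=.
  elim/ord3_ind; elim/ord3_ind; elim/ord3_ind;
    rewrite -!(inj_eq val_inj) /= !inordK //=;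
    by move=> [<-] [<-] [<-]; rewrite eqxx ?orbT.
have iso (s : {perm 'I_3}) : (forall u v,
    @ccol (K3 p q) (s u) (s v) = @ccol (tri (Some x) (Some y) (Some z)) u v) ->
    isomorphic (tri (Some x) (Some y) (Some z)) (K3 p q).
  by move=> hs; exists s; split=> //; apply: injF_bij; apply: perm_inj.
(* In each case the permutation moves the edge coloured [p] onto {0,1}. *)
case/or3P=> /eqP[dx dy dz]; subst x y z.
- apply: (iso 1%g).
  elim/ord3_ind; elim/ord3_ind; by rewrite !perm1 /= -!(inj_eq val_inj) /= !inordK.
- apply: (iso (tperm (inord 1) (inord 2))).
  elim/ord3_ind; elim/ord3_ind;
  by rewrite !permE /= -!(inj_eq val_inj) /= !inordK //= ?inordK.
- apply: (iso (tperm (inord 0) (inord 2))).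
  elim/ord3_ind; elim/ord3_ind;
  by rewrite !permE /= -!(inj_eq val_inj) /= !inordK //= ?inordK.
Qed.

(** * Reading the adjacency matrix from the input *)

Lemma nth_allpairs (S T R : Type) (f : S -> T -> R) s t x0 y0 z0 i j :
  i < size s -> j < size t ->
  nth z0 [seq f u v | u <- s, v <- t] (i * size t + j) =
    f (nth x0 s i) (nth y0 t j).
Proof.
elim: s i => // u s IH [|i] /=.
  by move=> _ lt_j; rewrite nth_cat size_map lt_j (nth_map y0).
move=> lt_i lt_j.
by rewrite nth_cat size_map mulSn -addnA ltnNge leq_addr addKn IH.
Qed.

Lemma adjacent_encode (G : sgraph) (u v : 'I_#|gvert G|) :
  adjacent (encode_graph G) u v = gedge (enum_val u) (enum_val v).
Proof.
(* The vertex [z] serves as default value for [nth]. The 1 in [cell] accounts for the vertex count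
   in front of the matrix. *)
have /card_gt0P[z _] : 0 < #|gvert G| := leq_ltn_trans (leq0n u) (ltn_ord u).
rewrite /adjacent /cell add1n addSn /= [X in u * X]cardE.
by rewrite (nth_allpairs _ z z) -?cardE ?ltn_ord // -!enum_val_nth lt0b.
Qed.

(** * Relations closed under majority are defined by 2-clauses *)

Definition maj (x y z : bool) : bool := [|| x && y, x && z | y && z].

Definition maj3 (r s t : bool * bool * bool) : bool * bool * bool :=
  (maj r.1.1 s.1.1 t.1.1, maj r.1.2 s.1.2 t.1.2, maj r.2 s.2 t.2).

Definition vals (s : bool * bool * bool) (v : nat) : bool :=
  nth false [:: s.1.1; s.1.2; s.2] v.

Definition small_literals : seq literal :=
  [seq (v, b) | v <- iota 0 3, b <- [:: true; false]].

(** Pairs of equal literals give unit clauses. For empty [A] every clause is kept, which makes the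
    formula unsatisfiable. *)
Definition template (A : pred (bool * bool * bool)) : cnf2 :=
  [seq C <- [seq (l, l') | l <- small_literals, l' <- small_literals]
     | [forall s, A s ==> sat_clause (vals s) C]].

Lemma mem_small_literals v b : ((v, b) \in small_literals) = (v < 3).
Proof.
apply/allpairsP/idP=> [[[w c] /= []]|lt_v3].
  by rewrite !inE => /or3P[]/eqP-> _ [-> _].
by exists (v, b); split=> //; [rewrite mem_iota | case: b].
Qed.

Lemma template_vars A : all (fun C => (C.1.1 < 3) && (C.2.1 < 3)) (template A).
Proof.
apply/allP=> C; rewrite mem_filter => /andP[_ /allpairsP[[[v b] [w c]] /= []]].
by rewrite !mem_small_literals => ? ? -> /=; apply/andP.
Qed.

(* If s satisfies all 2-clauses implied by A, any two coordinates of s are those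
   of a member of A, and s is the majority of the three members so obtained. *)
Lemma templateP (A : pred (bool * bool * bool)) :
  (forall r s t, A r -> A s -> A t -> A (maj3 r s t)) ->
  forall f, all (sat_clause f) (template A) = A (f 0, f 1, f 2).
Proof.
move=> closedA f; set s := (f 0, f 1, f 2).
have fE v : v < 3 -> f v = vals s v by case: v => [|[|[|]]].
apply/allP/idP=> [sat|As C]; last first.
  move=> CA; have /allP/(_ _ CA)/andP[v3 w3] := template_vars A.
  move: CA; rewrite mem_filter => /andP[/forallP/(_ s)/implyP/(_ As) + _].
  by rewrite /sat_clause /sat_lit !fE.
have pair v w : v < 3 -> w < 3 ->
    exists t, [/\ A t, vals t v = f v & vals t w = f w].
  (* [C] excludes exactly the values of [f] at [v] and [w]. As [f] falsifies it, it is not implied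
     by [A], and a counterexample in [A] agrees with [f] there. *)
  move=> v3 w3; pose C : clause := ((v, ~~ f v), (w, ~~ f w)).
  have: ~~ [forall t, A t ==> sat_clause (vals t) C].
    apply/negP=> CA; have := sat C.
    rewrite mem_filter CA allpairs_f ?mem_small_literals //=.
    by rewrite /sat_clause /sat_lit /= => /(_ isT); case: (f v); case: (f w).
  case/forallPn=> t; rewrite negb_imply /sat_clause /sat_lit /= => /andP[At nC].
  by exists t; move: nC; case: (f v); case: (f w); case: (vals t v); case: (vals t w).
have [r [Ar r0 r1]] := pair 0 1 isT isT.
have [t [At t0 t2]] := pair 0 2 isT isT.
have [u [Au u1 u2]] := pair 1 2 isT isT.
suff -> : s = maj3 r t u by apply: closedA.
move: r0 r1 t0 t2 u1 u2; rewrite /vals /s /maj3 /= => -> -> -> -> -> ->.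
by congr (_, _, _); rewrite /maj; case: (f 0); case: (f 1); case: (f 2);
  rewrite ?andbT ?andbF ?orbT.
Qed.

(** * Models of the printed formula and the time to print it *)

Lemma sat_rename f g C : sat_clause f (rename g C) = sat_clause (f \o g) C.
Proof. by []. Qed.

Lemma sat_graph_cnf tpl x f :
  all (sat_clause f) (graph_cnf tpl x (nth 0 x 0)) <->
  forall i j k, i < j -> j < k -> k < nth 0 x 0 ->
    all (sat_clause (f \o edge_var x i j k))
        (tpl (adjacent x i j, adjacent x i k, adjacent x j k)).
Proof.
split=> [sat i j k ij jk kn|sat].
  apply/allP=> C CA; rewrite -sat_rename; apply: (allP sat).
  set n := nth 0 x 0 in kn *.
  have jn := ltn_trans jk kn; have i_n := ltn_trans ij jn.
  apply/flatten_mapP; exists i; first by rewrite mem_iota.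
  apply/flatten_mapP; exists j; first by rewrite mem_iota.
  apply/flatten_mapP; exists k; first by rewrite mem_iota.
  apply/flatten_mapP; exists (adjacent x i j, adjacent x i k, adjacent x j k).
    exact: mem_enum.
  by rewrite /pattern_cnf ij jk eqxx; apply: map_f.
apply/allP=> C /flatten_mapP[i _] /flatten_mapP[j _] /flatten_mapP[k].
rewrite mem_iota /= add0n => kn /flatten_mapP[a _]; rewrite /pattern_cnf.
case: ifP => // /and3P[ij jk /eqP <-] /mapP[D DA ->].
exact: (allP (sat i j k ij jk kn)).
Qed.

(** Three nested loops of [n] rounds around a body whose cost [k_time tpl] is independent of the
    input give a cubic polynomial in [n]. *)
Lemma main_time_bound tpl x w : nth 0 x 0 < w ->
  main_time tpl x <= (k_time tpl + 20) * w ^ 3 + (k_time tpl + 20).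
Proof.
rewrite /main_time /i_time /j_time; move: (k_time tpl) (nth 0 x 0) => b n.
case: w => // w; rewrite ltnS => nw; rewrite !expnS expn0.
have: n * (n * (n * b)) <= w * (w * (w * b)) by rewrite !leq_mul.
have: n * (n * n) <= w * (w * w) by rewrite !leq_mul.
have: n * n <= w * w by rewrite !leq_mul.
nia.
Qed.

(** * Freeness as a condition on increasing triples *)

Lemma isomorphic_tri_induced (H : cgraph) (x y z : cvert H) :
  x != y -> x != z -> y != z ->
  isomorphic (tri (ccol x y) (ccol x z) (ccol y z)) (induced [set x; y; z]).
Proof.
move=> xy xz yz; pose s := [:: x; y; z].
have sS (u : 'I_3) : nth x s u \in [set x; y; z].
  by elim/ord3_ind: u; rewrite inordK //= !inE eqxx ?orbT.
pose f (u : 'I_3) : {w | w \in [set x; y; z]} := exist _ (nth x s u) (sS u).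
exists f; split.
  apply: inj_card_bij => [u v [/eqP]|]; last first.
    rewrite card_ord card_sig (eq_card (B := [set x; y; z])) => [|w];
      last by rewrite !inE.
    by rewrite -setUA cardsU1 cards2 !inE negb_or xy xz yz.
  by rewrite nth_uniq ?ltn_ord //= ?inE ?negb_or ?xy ?xz ?yz // => /eqP/val_inj.
elim/ord3_ind; elim/ord3_ind; rewrite /= -!(inj_eq val_inj) /= !inordK //= ?ccol_irr //;
  exact: ccol_sym.
Qed.

(** Members of [F] have three vertices, so only 3-element sets can violate freeness, and each is
    listed once by increasing rank. *)
Lemma is_freeP (F : cgraph -> Prop) (H : cgraph) :
  (forall K, F K -> #|cvert K| = 3) ->
  is_free F H <->
  forall i j k : 'I_#|cvert H|, i < j -> j < k ->
    let x := enum_val i in let y := enum_val j in let z := enum_val k in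
    ~ contains F (tri (ccol x y) (ccol x z) (ccol y z)).
Proof.
move=> F3; split=> [freeH i j k ij jk x y z|freeH S].
  move/contains_iso=> FS; apply: (freeH [set x; y; z]); apply: FS.
  apply: isomorphic_tri_induced; rewrite (inj_eq enum_val_inj) neq_ltn ?ij ?jk //.
  by rewrite (ltn_trans ij jk).
case=> K [FK KS]; have S3 : #|S| = 3.
  have [f [bf _]] := KS; rewrite -(F3 K FK) (bij_eq_card bf) card_sig.
  exact/esym/eq_card.
pose I := [set i : 'I_#|cvert H| | enum_val i \in S].
have I3 : size (enum I) = 3.
  rewrite -cardE -S3 -(card_imset _ enum_val_inj); apply: eq_card => x.
  apply/imsetP/idP=> [[i + ->]|xS]; first by rewrite inE.
  by exists (enum_rank x); rewrite ?inE enum_rankK.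
(* [enum] filters the increasing list of all ordinals, so the three ranks come out in increasing
   order. *)
have: sorted ltn (map val (enum I)).
  rewrite sorted_map {1}/enum_mem; apply: sorted_filter.
    by move=> ? ? ?; apply: ltn_trans.
  by rewrite -sorted_map -enumT val_enum_ord iota_ltn_sorted.
have memI i : (i \in enum I) = (enum_val i \in S) by rewrite mem_enum inE.
case: (enum I) I3 memI => [|i [|j [|k []]]] // _ memI /= /and3P[ij jk _].
apply: (freeH i j k ij jk); exists K; split=> //; apply: isomorphic_trans KS _.
apply: isomorphic_sym.
suff -> : S = [set enum_val i; enum_val j; enum_val k].
  apply: isomorphic_tri_induced; rewrite (inj_eq enum_val_inj) neq_ltn ?ij ?jk //.
  by rewrite (ltn_trans ij jk).
apply/setP=> x; rewrite -[x]enum_rankK -memI !inE.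
by rewrite !(inj_eq enum_val_inj) orbA.
Qed.

(** * Majority closure in the four cases *)

Definition edge_if (a x : bool) : option colour := if a then Some x else None.

(** Membership in [F] is decided classically. This is harmless: [F] is fixed, and only finitely many
    values enter the program, as its table. *)
Definition allowed (F : cgraph -> Prop) (a s : bool * bool * bool) : bool :=
  `[< ~ contains F (tri (edge_if a.1.1 s.1.1) (edge_if a.1.2 s.1.2)
                        (edge_if a.2 s.2)) >].

Definition triangle_cases (F : cgraph -> Prop) : Prop :=
  [\/ forall H, triangle H -> ~ contains F H,
      [/\ contains F rK3, contains F bK3, contains F rrbK3 & contains F rbbK3],
      forall H, triangle H ->
        (contains F H <-> isomorphic H rK3 \/ isomorphic H rrbK3)
    | forall H, triangle H ->
        (contains F H <-> isomorphic H bK3 \/ isomorphic H rbbK3)].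

(** Cases (a) and (b) give a constant. With [true] for red, case (c) forbids a red majority among
    the edges and case (d) a blue one. *)
Lemma allowed_trianglesE F : triangle_cases F ->
  exists b : bool, [\/ forall s, allowed F (true, true, true) s = b,
     forall s, allowed F (true, true, true) s = ~~ maj s.1.1 s.1.2 s.2
   | forall s, allowed F (true, true, true) s = maj s.1.1 s.1.2 s.2].
Proof.
have tri3 s := tri_triangle s.1.1 s.1.2 s.2.
case=> [noF|[Fr Fb Frrb Frbb]|FP|FP].
- exists true; apply: Or31 => s; apply/asboolP; exact: noF (tri3 s).
- exists false; apply: Or31 => -[[x y] z]; apply: asboolF => nF; apply: nF.
  have isoF p q K := contains_iso (isomorphic_sym (proj2 (tri_K3P x y z p q) K)).
  by case: x isoF; case: y; case: z => isoF;
    [apply: isoF Fr|apply: isoF Frrb|apply: isoF Frrb|apply: isoF Frbb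
    |apply: isoF Frrb|apply: isoF Frbb|apply: isoF Frbb|apply: isoF Fb].
- exists true; apply: Or32 => -[[x y] z].
  rewrite /allowed asbool_neg /=; congr (~~ _); rewrite -[RHS]asboolb.
  apply: asbool_equiv_eq; apply: iff_trans (FP _ (tri3 (x, y, z))) _.
  split=> [[]/tri_K3P|]; [by case: x y z => [] [] []..|].
  by case: x y z => [] [] [] //= _; [left|right..]; apply/tri_K3P.
- exists true; apply: Or33 => -[[x y] z].
  rewrite /allowed asbool_neg /= -[RHS]negbK; congr (~~ _); rewrite -[RHS]asboolb.
  apply: asbool_equiv_eq; apply: iff_trans (FP _ (tri3 (x, y, z))) _.
  split=> [[]/tri_K3P|]; [by case: x y z => [] [] []..|].
  by case: x y z => [] [] [] //= _; [right..|left]; apply/tri_K3P.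
Qed.

(** On triangles the relation is constant, at most one red edge, or at least two; the last two are
    defined by 2-clauses. *)
Lemma allowed_maj F a r s t : triangle_cases F ->
  allowed F a r -> allowed F a s -> allowed F a t -> allowed F a (maj3 r s t).
Proof.
case: a r s t => [[a b] c] [[x y] z] [[x' y'] z'] [[x'' y''] z''] casesF.
rewrite /maj3 /=; have [/and3P[-> -> ->]|] := boolP [&& a, b & c].
  have [d [E|E|E]] := allowed_trianglesE casesF; rewrite !E //=;
    by case: x; case: y; case: z; case: x'; case: y'; case: z';
      case: x''; case: y''; case: z''.
(* With at most two edges, each majority value is shared by two of the three members, so one member
   has both values: the majority agrees with it on all edges. *)
case: a; case: b; case: c => // _; rewrite /allowed /edge_if /=;
  by case: x; case: y; case: z; case: x'; case: y'; case: z';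
      case: x''; case: y''; case: z''.
Qed.

(** * Correctness of the reduction and its polynomial bound *)

Lemma size_le_wsize x : size x <= wsize x.
Proof. by rewrite /wsize -sum1_size; apply: leq_sum. Qed.

Lemma cell_decode n u v : v < n ->
  ((cell n u v).-1 %/ n, (cell n u v).-1 %% n) = (u, v).
Proof.
move=> vn; rewrite /cell add1n addSn /= divnMDl ?(leq_ltn_trans _ vn) //.
by rewrite divn_small // addn0 modnMDl modn_small.
Qed.

Lemma free_colouringP (F : cgraph -> Prop) (G : sgraph) :
  (forall K, F K -> #|cvert K| = 3) -> triangle_cases F ->
  let x := encode_graph G in
  @yes (free_colouring F) G <->
  @yes two_sat (graph_cnf (fun a => template (allowed F a)) x (nth 0 x 0)).
Proof.
move=> F3 casesF x; pose n := #|gvert G|.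
pose e (i j k : 'I_n) := (gedge (enum_val i) (enum_val j),
  gedge (enum_val i) (enum_val k), gedge (enum_val j) (enum_val k)).
have satE f : all (sat_clause f) (graph_cnf (fun a => template (allowed F a)) x n) <->
    forall i j k : 'I_n, i < j -> j < k -> allowed F (e i j k)
      (f (cell n i j), f (cell n i k), f (cell n j k)).
  split=> [/sat_graph_cnf sat i j k ij jk|sat].
    have := sat i j k ij jk (ltn_ord k).
    by rewrite !adjacent_encode templateP => // ? ? ?; apply: allowed_maj.
  apply/sat_graph_cnf => i j k ij jk kn; rewrite templateP; last first.
    by move=> ? ? ?; apply: allowed_maj.
  have jn := ltn_trans jk kn; have i_n := ltn_trans ij jn.
  have := sat (Ordinal i_n) (Ordinal jn) (Ordinal kn) ij jk.
  by rewrite /e -!adjacent_encode.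
split=> [[c freec]|[f /satE sat]].
  (* The assignment decodes a variable number back to a pair of vertices; numbers that decode to no
     pair get [true]. *)
  pose dec (w : nat) : option (gvert G) := omap enum_val (insub w : option 'I_n).
  pose f v := if (dec (v.-1 %/ n), dec (v.-1 %% n)) is (Some y, Some z)
              then colour_of c y z else true.
  have fE (i j : 'I_n) : f (cell n i j) = colour_of c (enum_val i) (enum_val j).
    by rewrite /f /dec; have [-> ->] := cell_decode i (ltn_ord j); rewrite !valK.
  exists f; apply/satE => i j k ij jk; apply/asboolP; rewrite !fE.
  exact: (proj1 (is_freeP _ F3) freec i j k ij jk).
(* Sorting the ranks makes the colouring symmetric and, for distinct vertices, selects the matrix
   entry above the diagonal, the one the clauses mention. *)
pose var (u v : gvert G) :=
  cell n (minn (enum_rank u) (enum_rank v)) (maxn (enum_rank u) (enum_rank v)).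
have sym u v : f (var u v) = f (var v u) by rewrite /var minnC maxnC.
exists (Colouring sym); apply/is_freeP => // i j k ij jk.
have := sat i j k ij jk => /asboolP.
have varE (u v : 'I_n) : u < v -> var (enum_val u) (enum_val v) = cell n u v.
  by move=> /ltnW uv; rewrite /var !enum_valK (minn_idPl uv) (maxn_idPr uv).
by rewrite /= !varE // (ltn_trans ij jk).
Qed.

Theorem lemma36 (F : cgraph -> Prop)
    (F3 : forall H, F H -> #|cvert H| = 3)
    (cases :
      (* (a) *)
      (forall H, triangle H -> ~ contains F H) \/
      (* (b) *)
      (contains F rK3 /\ contains F bK3 /\
       contains F rrbK3 /\ contains F rbbK3) \/
      (* (c) *)
      (forall H, triangle H ->
         (contains F H <-> isomorphic H rK3 \/ isomorphic H rrbK3)) \/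
      (* (d) *)
      (forall H, triangle H ->
         (contains F H <-> isomorphic H bK3 \/ isomorphic H rbbK3))) :
  poly_reduces (free_colouring F) two_sat.
Proof.
have casesF : triangle_cases F.
  case: cases => [h|[[? [? [? ?]]]|[h|h]]];
    [exact: Or41|exact: Or42|exact: Or43|exact: Or44].
pose tpl a := template (allowed F a).
exists (fun G => graph_cnf tpl (encode_graph G) (nth 0 (encode_graph G) 0)).
split; last by move=> G; apply: free_colouringP.
exists (main_code tpl 0), (k_time tpl + 20), 3 => G.
apply: outputs_of_hoare (hoare_main _ _) _; first by move=> a; apply: template_vars.
apply: main_time_bound; apply: leq_trans (size_le_wsize _).
(* The encoding has [n * n + 1] entries of at least one bit each, so [n] is smaller than its bit
   length. *)
rewrite /= size_allpairs -cardE ltnS; case: #|_| => // n.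
exact: leq_pmulr.
Qed.
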